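(* Let $X$ be the Cantor set, $\mathcal{B}$ its Boolean algebra of clopen subsets, and let $G\leq \mathrm{Homeo}(X)\cong\mathrm{Aut}(\mathcal{B})$ be an ample group. Given any decomposition $G=\bigcup_{n\in\mathbb{N}}H_n$ of $G$ as a direct (increasing) union of finite subgroups $H_n$, there exist finite subgroups $G_n\leq G$ and finite subalgebras $\mathcal{B}_n\leq\mathcal{B}$ such that for each $n\in\mathbb{N}$: (1) $G_n\geq H_n$; (2) $\mathcal{B}_n$ is $H_n$-invariant; (3) $G_n$ is piecewise full on $\mathcal{B}_n$, and the setwise stabiliser in $G_n$ of any atom of $\mathcal{B}_n$ coincides with its pointwise stabiliser; (4) $G_n=\bigoplus_{i=1}^{m_n}\mathrm{Sym}(\mathcal{O}_i)$, where $\mathcal{O}_1,\dots,\mathcal{O}_{m_n}$ are the $H_n$-orbits on $\mathrm{at}(\mathcal{B}_n)$; (5) $G_n\le G_{n+1}$ and the embeddings $G_n\hookrightarrow G_{n+1}$ are block-diagonal: writing $\mathcal{Q}_1,\dots,\mathcal{Q}_{m_{n+1}}$ for the $H_{n+1}$-orbits on $\mathrm{at}(\mathcal{B}_{n+1})$, for each $H_n$-orbit $\mathcal{O}$ on $\mathrm{at}(\mathcal{B}_n)$ the factor $\mathrm{Sym}(\mathcal{O})$ embeds diagonally in $\bigoplus_{j=1}^{s}\mathrm{Sym}(\mathcal{O}'_j)\leq\bigoplus_{i\in I}\mathrm{Sym}(\mathcal{Q}_i)$ for some $I\subseteq\{1,\dots,m_{n+1}\}$, where each $\mathcal{O}'_j$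 is an $H_n$-orbit on $\mathrm{at}(\mathcal{B}_{n+1})$ that is permutation-isomorphic to $\mathcal{O}$, and each $\mathcal{O}'_j$ is contained in some $H_{n+1}$-orbit $\mathcal{Q}_i$, inducing the natural embedding $\mathrm{Sym}(\mathcal{O}'_j)\leq\mathrm{Sym}(\mathcal{Q}_i)$. Moreover, if $G$ is uniformly discrete with respect to the clopen partition $P=\{U_1,\dots,U_k\}$, then $G_n$ and $\mathcal{B}_n$ can be found such that $\mathrm{at}(\mathcal{B}_n)$ is a refinement of $P$ and each $\mathcal{O}_i$ consists of at most $k$ atoms, each in a different part of $P$.
   Context: For a finite subalgebra $\mathcal{A}\le\mathcal{B}$, $\mathrm{at}(\mathcal{A})$ is its set of atoms (minimal nonzero elements), which is a clopen partition of $X$. For $G\le \mathrm{Homeo}(X)$ and a $G$-invariant subalgebra $\mathcal{A}\le\mathcal{B}$, $\mathbf{F}_{\mathcal{A}}(G)$ is the group of all $g\in\mathrm{Homeo}(X)$ for which there are a finite partition $X=U_1\sqcup\dots\sqcup U_n$ with all $U_i\in\mathcal{A}$ and $g_1,\dots,g_n\in G$ with $g|_{U_i}=g_i|_{U_i}$. $G$ is piecewise full on $\mathcal{A}$ if $\mathcal{A}$ is $G$-invariant and $\mathbf{F}_{\mathcal{A}}(G)=G$; $G$ is piecewise full if it is piecewise full on $\mathcal{B}$. $G\le\mathrm{Homeo}(X)$ is ample if it is piecewise full, locally finite (every finite subset lies in a finite subgroup), countable, and for every $g\in G$ the set $\mathrm{Fix}(g)$ of fixed points is clopen. $G$ is uniformly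 discrete with respect to a clopen partition $P$ of $X$ if $|Gx\cap U|\le 1$ for all $x\in X$, $U\in P$. The equality in (4) means that $G_n$ acts faithfully on $\mathrm{at}(\mathcal{B}_n)$ and that its image is the group of all permutations of $\mathrm{at}(\mathcal{B}_n)$ preserving each $\mathcal{O}_i$. ''Embeds diagonally'' in (5) means that $\sigma\in\mathrm{Sym}(\mathcal{O})$ is sent to $(\sigma_1,\dots,\sigma_s)$, where $\sigma_j$ corresponds to $\sigma$ under a fixed bijection $\mathcal{O}\to\mathcal{O}'_j$ (and $\mathrm{Sym}(\mathcal{O})$ acts trivially on all other atoms of $\mathcal{B}_{n+1}$). *)

(* Defs.v *)
From HB Require Import structures.
From mathcomp Require Import all_boot.
From mathcomp Require Import boolp classical_sets functions cardinality.
From mathcomp Require Import topology measure cantor.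

Set Implicit Arguments.
Unset Strict Implicit.
Unset Printing Implicit Defensive.

Local Open Scope classical_set_scope.

(** * The group Homeo(X) *)

Record homeo (T : topologicalType) := Homeo {
  homeo_fun :> T -> T;
  homeo_inv : T -> T;
  homeo_funK : cancel homeo_fun homeo_inv;
  homeo_invK : cancel homeo_inv homeo_fun;
  homeo_fun_continuous : continuous homeo_fun;
  homeo_inv_continuous : continuous homeo_inv }.

Lemma homeo_ext (T : topologicalType) (f g : homeo T) : f =1 g -> f = g.
Proof.
case: f g => [f f' fK f'K fc f'c] [g g' gK g'K gc g'c] /= /funext fg.
case: g / fg gK g'K gc => gK g'K gc.
have fg' : f' = g' by apply/funext => x; rewrite -{1}(g'K x) fK.
case: g' / fg' gK g'K g'c => gK g'K g'c.
by congr Homeo; exact: Prop_irrelevance.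
Qed.

HB.instance Definition _ (T : topologicalType) := gen_eqMixin (homeo T).
HB.instance Definition _ (T : topologicalType) := gen_choiceMixin (homeo T).

Section HomeoGroup.
Variable T : topologicalType.
Implicit Types f g h : homeo T.

Definition homeo_one : homeo T :=
  @Homeo T id id (fun=> erefl) (fun=> erefl)
    (fun x => @cvg_id _ (nbhs x)) (fun x => @cvg_id _ (nbhs x)).

Definition homeo_inverse f : homeo T :=
  Homeo (homeo_invK f) (homeo_funK f)
        (@homeo_inv_continuous T f) (@homeo_fun_continuous T f).

Definition homeo_mul f g : homeo T :=
  Homeo (can_comp (homeo_funK f) (homeo_funK g))
        (can_comp (homeo_invK g) (homeo_invK f))
        (fun x => continuous_comp (@homeo_fun_continuous T g x)
                                  (@homeo_fun_continuous T f (g x)))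
        (fun x => continuous_comp (@homeo_inv_continuous T f x)
                                  (@homeo_inv_continuous T g (homeo_inv f x))).

Fact homeo_mulA : associative homeo_mul.
Proof. by move=> f g h; exact: homeo_ext. Qed.
Fact homeo_mul1g : left_id homeo_one homeo_mul.
Proof. by move=> f; exact: homeo_ext. Qed.
Fact homeo_mulg1 : right_id homeo_one homeo_mul.
Proof. by move=> f; exact: homeo_ext. Qed.
Fact homeo_mulVg : left_inverse homeo_one homeo_inverse homeo_mul.
Proof. by move=> f; apply: homeo_ext => x /=; exact: homeo_funK. Qed.
Fact homeo_mulgV : right_inverse homeo_one homeo_inverse homeo_mul.
Proof. by move=> f; apply: homeo_ext => x /=; exact: homeo_invK. Qed.

HB.instance Definition _ := isGroup.Build (homeo T)
  homeo_mulA homeo_mul1g homeo_mulg1 homeo_mulVg homeo_mulgV.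

End HomeoGroup.

Definition subgroup (gT : groupType) (G : set gT) : Prop := group_closed (mem G).

(** * Permutations of a set *)

(* Permutations of a set S are encoded as total functions fixing every point
   outside of S, so that Sym O `<=` Sym S is the natural embedding when
   O `<=` S. *)
Definition Sym (I : Type) (S : set I) : set (I -> I) :=
  [set s | set_bij S S s /\ forall a, ~ S a -> s a = a].

(* The internal direct sum of the groups Sym O, O \in OO, inside Sym S, when OO
   is the set of blocks of a partition of S. *)
Definition Sym_sum (I : Type) (S : set I) (OO : set (set I)) : set (I -> I) :=
  [set s | Sym S s /\ forall O, OO O -> s @` O = O].

Section AmpleGroups.
Variable X : topologicalType.
Implicit Types (A B : set (set X)) (G H : set (homeo X)) (g h : homeo X).

(** * Subalgebras of the algebra of clopen sets, and their atoms *)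

Definition is_subalgebra A : Prop :=
  [/\ A `<=` clopen, A set0, setU_closed A & setC_closed A].

Definition atoms A : set (set X) :=
  [set a | [/\ A a, a !=set0 &
               forall b, A b -> b !=set0 -> b `<=` a -> b = a]].

Definition invariant G A : Prop := forall g U, G g -> A U -> A (g @` U).

(** * Ample groups *)

Definition F_closure A G : set (homeo X) :=
  [set g | exists (n : nat) (U : 'I_n -> set X) (gs : 'I_n -> homeo X),
    [/\ partition [set: 'I_n] U [set: X], forall i, A (U i), forall i, G (gs i) &
        forall i x, U i x -> g x = gs i x]].

Definition piecewise_full_on A G : Prop := invariant G A /\ F_closure A G = G.

Definition piecewise_full G : Prop := piecewise_full_on clopen G.

Definition locally_finite G : Prop :=
  forall S : set (homeo X), finite_set S -> S `<=` G ->
    exists K : set (homeo X), [/\ subgroup K, finite_set K, S `<=` K & K `<=` G].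

Definition Fix g : set X := [set x | g x = x].

Definition ample G : Prop :=
  [/\ subgroup G, piecewise_full G, locally_finite G, countable G &
      forall g, G g -> clopen (Fix g)].

Definition clopen_partition (k : nat) (U : 'I_k -> set X) : Prop :=
  partition [set: 'I_k] U [set: X] /\ forall i, clopen (U i).

Definition uniformly_discrete G (k : nat) (U : 'I_k -> set X) : Prop :=
  forall x i, is_subset1 ([set g x | g in G] `&` U i).

Definition direct_union G (H : nat -> set (homeo X)) : Prop :=
  [/\ forall n, subgroup (H n), forall n, finite_set (H n),
      forall n, H n `<=` H n.+1 & G = \bigcup_n H n].

(** * Actions on atoms *)

Definition setwise_stab G (a : set X) : set (homeo X) :=
  [set g | G g /\ g @` a = a].

Definition pointwise_stab G (a : set X) : set (homeo X) :=
  [set g | G g /\ forall x, a x -> g x = x].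

Definition orbits G (S : set (set X)) : set (set (set X)) :=
  [set [set g @` a | g in G] | a in S].

Definition act_atoms A g : set X -> set X :=
  fun a => if `[< atoms A a >] then g @` a else a.

(* phi exhibits O and O' as isomorphic H-sets. *)
Definition perm_iso H (O O' : set (set X)) (phi : set X -> set X) : Prop :=
  set_bij O O' phi /\
  forall h a, H h -> O a -> phi (h @` a) = h @` (phi a).

(** * The conclusions *)

(* G' is the direct sum of the groups Sym O, for O an H-orbit on the atoms
   of A: the action of G' on the atoms is faithful, with that sum as image. *)
Definition is_sum_of_Sym G' H A : Prop :=
  set_inj G' (act_atoms A) /\
  act_atoms A @` G' = Sym_sum (atoms A) (orbits H (atoms A)).

(* The images of s : Sym O under the bijections phi j : O -> O' j act on the
   O' j, and all other atoms of A are fixed. *)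
Definition acts_diagonally A (O : set (set X)) (r : nat)
    (O' : 'I_r -> set (set X)) (phi : 'I_r -> set X -> set X)
    (s : set X -> set X) g : Prop :=
  (forall j a, O a -> act_atoms A g (phi j a) = phi j (s a)) /\
  (forall b, atoms A b -> (forall j, ~ O' j b) -> act_atoms A g b = b).

(* The inclusion of G1 in G2 is block-diagonal. A permutation s in Sym O is
   realised by the element g of G1 acting on the atoms of A1 as s. *)
Definition block_diagonal G1 H1 A1 H2 A2 : Prop :=
  forall O, orbits H1 (atoms A1) O ->
  exists (r : nat) (O' : 'I_r -> set (set X)) (phi : 'I_r -> set X -> set X)
         (QQ : set (set (set X))),
    [/\ (0 < r)%N /\ injective O',
        forall j, orbits H1 (atoms A2) (O' j),
        forall j, perm_iso H1 O (O' j) (phi j),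
        QQ `<=` orbits H2 (atoms A2) /\
          (forall j, exists2 Q, QQ Q & O' j `<=` Q) &
        forall s g, Sym O s -> G1 g -> act_atoms A1 g = s ->
          acts_diagonally A2 O O' phi s g].

Definition block_diagonal_sequence G (H Gs : nat -> set (homeo X))
    (Bs : nat -> set (set X)) : Prop :=
  forall n,
    [/\ [/\ subgroup (Gs n), finite_set (Gs n) & Gs n `<=` G],
        is_subalgebra (Bs n) /\ finite_set (Bs n) &
        [/\ H n `<=` Gs n,
            invariant (H n) (Bs n),
            piecewise_full_on (Bs n) (Gs n) /\
              (forall a, atoms (Bs n) a ->
                setwise_stab (Gs n) a = pointwise_stab (Gs n) a),
            is_sum_of_Sym (Gs n) (H n) (Bs n) &
            Gs n `<=` Gs n.+1 /\
              block_diagonal (Gs n) (H n) (Bs n) (H n.+1) (Bs n.+1)]].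

Definition adapted_to (k : nat) (U : 'I_k -> set X)
    (H : nat -> set (homeo X)) (Bs : nat -> set (set X)) : Prop :=
  forall n,
    (forall a, atoms (Bs n) a -> exists i, a `<=` U i) /\
    (forall O, orbits (H n) (atoms (Bs n)) O ->
      (O #<= `I_k)%card /\ forall i, is_subset1 (O `&` [set a | a `<=` U i])).

End AmpleGroups.

(* Main.v *)
Require Import Defs.
From mathcomp Require Import all_boot.
From mathcomp Require Import boolp classical_sets functions cardinality.
From mathcomp Require Import topology measure cantor.

Set Implicit Arguments.
Unset Strict Implicit.
Unset Printing Implicit Defensive.

Local Open Scope classical_set_scope.

(** For each [h] in [G] the set [Fix h] is clopen, so by compactness finitely
    many clopen sets separate every moved point [x] from [h x]. Let [B_n] be the
    algebra generated by the [H_n]-translates of these sets for [h] in [H_n].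
    If [h] in [H_n] stabilises an atom of [B_n], it moves no point of it, since
    [x] and [h x] are not separated. Hence an element of [H_n] is determined on
    an atom [a] by the image of [a], and [G_n], the group of homeomorphisms
    which are piecewise in [H_n] on [B_n], consists of all the permutations of
    the atoms preserving the [H_n]-orbits, each realised by exactly one element.
    An atom [b] of [B_(n+1)] lies below an atom [a] of [B_n] and, the stabiliser
    of [a] being trivial on [a], it is the only translate of [b] below [a]: so
    the [H_n]-orbit of [b] is isomorphic to that of [a]. For the last claim, add
    the parts of [P] to the generators. *)

(** * Preliminaries on finite sets and continuity *)

(** Injectivity keeps the pieces disjoint in [F_closureP] and the orbits [O'] distinct in
    [F_block_diagonal]. *)
Lemma finite_set_enum (T : Type) (D : set T) : finite_set D ->
  exists (n : nat) (f : 'I_n -> T), injective f /\ range f = D.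
Proof.
elim/Pchoice: T D => T D /finite_seqP[s ->].
exists (size (undup s)), (tnth (in_tuple (undup s))); split.
  by apply/tuple_uniqP; exact: undup_uniq.
apply/seteqP; split=> [_ [i _ <-]|x]; rewrite /= -mem_undup.
  exact: mem_tnth.
by move=> /(@tnthP _ _ (in_tuple (undup s)))[i ->]; exists i.
Qed.

Lemma finite_powerset (T : Type) (D : set T) : finite_set D ->
  finite_set [set B | B `<=` D].
Proof.
move=> /finite_set_enum[n [f [_ <-]]].
apply: (@sub_finite_set _ _ ((fun s : {set 'I_n} => f @` [set` s]) @` setT)).
  move=> B BD; exists [set i | `[< B (f i) >]]%SET => //.
  apply/seteqP; split=> [_ [i /= + <-]|x Bx]; first by rewrite inE => /asboolP.
  have [i _ fi] := BD x Bx; exists i; rewrite //= inE.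
  by apply/asboolP; rewrite fi.
exact/finite_image/finite_finset.
Qed.

Lemma locally_eq_continuous (X Y : topologicalType) (f : X -> Y) :
  (forall x, exists U k, [/\ open U, U x, continuous k &
     forall y, U y -> f y = k y]) -> continuous f.
Proof.
move=> fk x; have [U [k [Uo Ux kc fkU]]] := fk x.
have E : {near x, k =1 f}.
  by apply: filterS (open_nbhs_nbhs (conj Uo Ux)) => y /fkU.
apply: cvg_trans (near_eq_cvg E) _.
by rewrite fkU //; exact: kc.
Qed.

(** * Subgroups of homeomorphisms and their action on sets *)

Section Subgroup.
Variables (X : topologicalType) (H : set (homeo X)).
Hypothesis Hsub : subgroup H.

Lemma subgroup1 : H 1%g.
Proof. by case: Hsub => /set_mem. Qed.

Lemma subgroupV h : H h -> H (h^-1)%g.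
Proof. by move=> Hh; apply/set_mem/(group_closedV Hsub)/mem_set. Qed.

Lemma subgroupM h k : H h -> H k -> H (h * k)%g.
Proof. by move=> Hh Hk; apply/set_mem/(group_closedM Hsub); exact/mem_set. Qed.

End Subgroup.

Section Homeo.
Variable X : topologicalType.
Implicit Types (g h : homeo X) (a b : set X).

Lemma homeoVK g : cancel g (g^-1)%g. Proof. exact: homeo_funK. Qed.

Lemma homeoKV g : cancel (g^-1)%g g. Proof. exact: homeo_invK. Qed.

Lemma image_homeoM g h a : (g * h)%g @` a = g @` (h @` a).
Proof. by rewrite -image_comp. Qed.

Lemma image_homeoVK g a : (g^-1)%g @` (g @` a) = a.
Proof.
rewrite image_comp -[RHS]image_id; apply: eq_imagel => x _ /=.
exact: homeoVK.
Qed.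

Lemma image_homeoKV g a : g @` ((g^-1)%g @` a) = a.
Proof.
rewrite image_comp -[RHS]image_id; apply: eq_imagel => x _ /=.
exact: homeoKV.
Qed.

Lemma image_homeo1 a : (1%g : homeo X) @` a = a. Proof. exact: image_id. Qed.

Lemma image_homeo_preimage g a : g @` a = (g^-1)%g @^-1` a.
Proof.
apply/seteqP; split=> [_ [x ax <-]|x ax].
  exact: (eq_ind_r a ax (homeoVK g x)).
by exists ((g^-1)%g x) => //; exact: homeoKV.
Qed.

Lemma image_homeo_clopen g a : clopen a -> clopen (g @` a).
Proof.
move=> ca; rewrite image_homeo_preimage; apply: preimage_clopen => //.
exact: homeo_fun_continuous.
Qed.

End Homeo.

(** * Atoms of a subalgebra of clopen sets *)

Section Atoms.
Variables (X : topologicalType) (A : set (set X)).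
Hypothesis Aalg : is_subalgebra A.
Implicit Types (a b U : set X).

Lemma subalgebraI U V : A U -> A V -> A (U `&` V).
Proof.
case: Aalg => _ _ Un Co AU AV; rewrite -(setCK (U `&` V)) setCI.
by apply/Co/Un; exact: Co.
Qed.

(** The intersection of [a] and [U] is a nonempty element below [a], so minimality makes it equal to
    [a]. *)
Lemma atom_sub a U x : atoms A a -> A U -> a x -> U x -> a `<=` U.
Proof.
move=> [Aa _ amin] AU ax Ux; apply/setIidPl/amin; first exact: subalgebraI.
  by exists x.
exact: subIsetl.
Qed.

Lemma atom_eq a b x : atoms A a -> atoms A b -> a x -> b x -> a = b.
Proof.
move=> aA bA ax bx; apply/seteqP; split.
  by apply: (atom_sub aA _ ax bx); case: bA.
by apply: (atom_sub bA _ bx ax); case: aA.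
Qed.

End Atoms.

(** * Regular pairs *)

(** What is required of [H_n] and [B_n] at a single stage. The decisive field is [reg_stab]; the
    structure of [G_n] is derived from it. *)
Record regular (X : topologicalType) (H : set (homeo X)) (A : set (set X)) :
    Prop := Regular {
  reg_subgroup : subgroup H;
  reg_alg : is_subalgebra A;
  reg_fin : finite_set A;
  reg_cover : forall x, exists2 a, atoms A a & a x;
  reg_inv : Defs.invariant H A;
  reg_stab : forall h a x, H h -> atoms A a -> h @` a = a -> a x -> h x = x }.

Lemma F_closure_mono (X : topologicalType) (A A' : set (set X))
    (H H' : set (homeo X)) : A `<=` A' -> H `<=` H' ->
  F_closure A H `<=` F_closure A' H'.
Proof.
move=> AA' HH' g [n [U [gs [PU AU Hgs gU]]]]; exists n, U, gs; split=> // i.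
  exact/AA'/AU.
exact/HH'/Hgs.
Qed.

(** An atom meeting a piece lies inside it, so the partition can be taken to be that into atoms. [H]
    is an arbitrary set here, so that the criterion also applies to a closure in
    [F_piecewise_full]. *)
Lemma F_closureP (X : topologicalType) (A : set (set X)) (H : set (homeo X)) g :
  is_subalgebra A -> finite_set A -> (forall x, exists2 a, atoms A a & a x) ->
  F_closure A H g <->
  (forall a, atoms A a -> exists2 h, H h & forall x, a x -> g x = h x).
Proof.
move=> Aalg Afin Acov; split.
  move=> [n [U [gs [[Uc _ _] AU Hgs gU]]]] a aA; have [_ [x ax] _] := aA.
  have [i _ Uix] : cover setT U x by rewrite Uc.
  exists (gs i) => // y ay; apply: gU.
  exact: (atom_sub Aalg aA (AU i) ax).
move=> gA.
have [n [e [eI eA]]] : exists (n : nat) (e : 'I_n -> set X),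
    injective e /\ range e = atoms A.
  by apply: finite_set_enum; apply: sub_finite_set Afin => a [].
have eAt i : atoms A (e i) by rewrite -eA; exists i.
have /choice[gs gsP] : forall i, exists h, H h /\ forall x, e i x -> g x = h x.
  by move=> i; have [h Hh gh] := gA _ (eAt i); exists h.
exists n, e, gs; split.
- split; last by move=> i _; case: (eAt i).
    apply/seteqP; split=> // x _; have [a aA ax] := Acov x.
    by move: aA; rewrite -eA => -[i _ ea]; exists i; rewrite // ea.
  move=> i j _ _ [x [ix jx]]; apply: eI.
  exact: (atom_eq Aalg (eAt i) (eAt j) ix jx).
- by move=> i; case: (eAt i).
- by move=> i; case: (gsP i).
- by move=> i x ix; case: (gsP i) => _; exact.
Qed.

(** * The finite group of homeomorphisms piecewise in [H] *)

Section Regular.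
Variables (X : topologicalType) (H : set (homeo X)) (A : set (set X)).
Hypothesis HA : regular H A.
Local Notation F := (F_closure A H).
Let Aalg := reg_alg HA.
Let Hsub := reg_subgroup HA.
Implicit Types (g h : homeo X) (a b : set X).

Lemma regularP g : F g <->
  (forall a, atoms A a -> exists2 h, H h & forall x, a x -> g x = h x).
Proof. apply: F_closureP => //; [exact: reg_fin HA|exact: reg_cover HA]. Qed.

Lemma F_image g a : F g -> atoms A a ->
  exists h, [/\ H h, g @` a = h @` a & forall x, a x -> g x = h x].
Proof.
move=> /regularP gA /gA[h Hh gh]; exists h; split=> //.
exact: eq_imagel.
Qed.

Lemma subgroup_atom h a : H h -> atoms A a -> atoms A (h @` a).
Proof.
move=> Hh [Aa [x ax] amin]; split.
- exact: (reg_inv HA).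
- by exists (h x), x.
- move=> b Ab [y by_] bha; rewrite -(image_homeoKV h b); congr (_ @` _).
  apply: amin.
  + by apply: (reg_inv HA) => //; exact: subgroupV.
  + by exists ((h^-1)%g y), y.
  + by rewrite -(image_homeoVK h a); exact: image_subset.
Qed.

Lemma F_atom g a : F g -> atoms A a -> atoms A (g @` a).
Proof.
by move=> Fg aA; have [h [Hh -> _]] := F_image Fg aA; exact: subgroup_atom.
Qed.

Lemma subgroup_sub_F : H `<=` F.
Proof. by move=> h Hh; apply/regularP => a aA; exists h. Qed.

(** The product of [k^-1] and [h] stabilises [a], hence fixes it pointwise by [reg_stab]. *)
Lemma regular_agree h k a x : H h -> H k -> atoms A a -> h @` a = k @` a ->
  a x -> h x = k x.
Proof.
move=> Hh Hk aA hka ax; rewrite -[LHS](homeoKV k); congr (k _).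
apply: (@reg_stab _ _ _ HA ((k^-1)%g * h)%g a) => //.
  by apply: subgroupM => //; exact: subgroupV.
by rewrite image_homeoM hka image_homeoVK.
Qed.

Lemma F_agree g g' a x : F g -> F g' -> atoms A a -> g @` a = g' @` a ->
  a x -> g x = g' x.
Proof.
move=> Fg Fg' aA.
have [h [Hh -> gh]] := F_image Fg aA; have [k [Hk -> gk]] := F_image Fg' aA.
by move=> hk ax; rewrite gh // gk //; exact: regular_agree hk ax.
Qed.

Lemma F_subgroup : subgroup F.
Proof.
split; first exact/mem_set/subgroup_sub_F/(subgroup1 Hsub).
move=> u v /set_mem Fu /set_mem Fv; apply/mem_set/regularP => b bA.
(* Let [a] be the atom that [v] carries onto [b]. If [v = h] and [u = k] on [a], then [u * v^-1]
   agrees with [k * h^-1] on [b]. *)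
have [_ [x bx] _] := bA.
have [a aA ax] := reg_cover HA ((v^-1)%g x).
have [h [Hh va vh]] := F_image Fv aA; have [k [Hk _ uk]] := F_image Fu aA.
have hab : h @` a = b.
  apply: (atom_eq Aalg _ bA _ bx); first exact: subgroup_atom.
  by rewrite -va; exists ((v^-1)%g x) => //; exact: homeoKV.
exists (k * h^-1)%g; first by apply: subgroupM => //; exact: subgroupV.
rewrite -hab => _ [w aw <-].
rewrite -[LHS]/(u ((v^-1)%g (h w))) -[RHS]/(k ((h^-1)%g (h w))).
by rewrite homeoVK -vh // homeoVK uk.
Qed.

Lemma F_invariant : Defs.invariant F A.
Proof.
move=> g U [n [V [gs [[Vc _ _] AV Hgs gV]]]] AU.
have -> : g @` U = \bigcup_(i in [set: 'I_n]) (gs i @` (U `&` V i)).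
  apply/seteqP; split=> [_ [x Ux <-]|_ [i _ [x [Ux Vx] <-]]].
    have [i _ Vix] : cover setT V x by rewrite Vc.
    by exists i => //; exists x => //; rewrite (gV i).
  by exists x => //; rewrite (gV i).
have [_ A0 AUc _] := Aalg.
apply: (iffLR (fin_bigcup_closedP A)) => // i _.
apply: (reg_inv HA) => //; exact: subalgebraI.
Qed.

(** The closure is idempotent: on an atom, a map piecewise in [F] agrees with an element of [F],
    hence with one of [H]. *)
Lemma F_piecewise_full : piecewise_full_on A F.
Proof.
split; first exact: F_invariant.
apply/seteqP; split=> g.
  move=> /(F_closureP _ _ Aalg (reg_fin HA) (reg_cover HA)) gA.
  apply/regularP => a aA; have [f Ff gf] := gA a aA.
  have [h [Hh _ fh]] := F_image Ff aA.
  by exists h => // x ax; rewrite gf // fh.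
move=> Fg; apply/(F_closureP _ _ Aalg (reg_fin HA) (reg_cover HA)) => a aA.
by exists g.
Qed.

Lemma F_stab a : atoms A a -> setwise_stab F a = pointwise_stab F a.
Proof.
move=> aA; apply/seteqP; split=> g [Fg ga]; split=> //.
  move=> x ax; apply: (F_agree Fg (subgroup_sub_F (subgroup1 Hsub)) aA _ ax).
  by rewrite ga image_homeo1.
by rewrite -[RHS]image_id; exact: eq_imagel.
Qed.

Lemma act_atomsE g a : atoms A a -> act_atoms A g a = g @` a.
Proof. by move=> aA; rewrite /act_atoms asboolT. Qed.

Lemma act_atoms_out g a : ~ atoms A a -> act_atoms A g a = a.
Proof. by move=> aA; rewrite /act_atoms asboolF. Qed.

Lemma orbit_atoms O a : orbits H (atoms A) O -> O a -> atoms A a.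
Proof. by move=> [b bA <-] [h Hh <-]; exact: subgroup_atom. Qed.

Lemma orbit_closed O a h : orbits H (atoms A) O -> O a -> H h -> O (h @` a).
Proof.
move=> [b bA <-] [k Hk <-] Hh; exists (h * k)%g; first exact: subgroupM.
by rewrite image_homeoM.
Qed.

Lemma orbit_trans O a b : orbits H (atoms A) O -> O a -> O b ->
  exists2 h, H h & b = h @` a.
Proof.
move=> [c cA <-] [h Hh <-] [k Hk <-]; exists (k * h^-1)%g.
  by apply: subgroupM => //; exact: subgroupV.
by rewrite image_homeoM image_homeoVK.
Qed.

Lemma orbit_refl a : [set h @` a | h in H] a.
Proof. by exists 1%g; [exact: subgroup1|exact: image_homeo1]. Qed.

Lemma F_orbit g O a : F g -> orbits H (atoms A) O -> O a -> O (g @` a).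
Proof.
move=> Fg OO Oa; have [h [Hh -> _]] := F_image Fg (orbit_atoms OO Oa).
exact: orbit_closed.
Qed.

(** By [F_agree] an element is determined by the graph of its action on the atoms, a subset of a
    finite product. *)
Lemma F_finite : finite_set F.
Proof.
have atfin : finite_set (atoms A) by apply: sub_finite_set (reg_fin HA) => a [].
pose gr g := [set p | atoms A p.1 /\ p.2 = g @` p.1].
have gr_inj : {in F &, injective gr}.
  move=> g g' /set_mem Fg /set_mem Fg' gg'; apply: homeo_ext => x.
  have [a aA ax] := reg_cover HA x; apply: (F_agree Fg Fg' aA _ ax).
  by have [] : gr g' (a, g @` a) by rewrite -gg'.
rewrite -(eq_finite_set (inj_card_eq gr_inj)).
apply: sub_finite_set (finite_powerset (finite_setX atfin atfin)).
move=> _ [g Fg <-] [a b] [/= aA bE]; split=> //=.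
by rewrite bE; exact: F_atom.
Qed.

(** The atoms form an open partition, and so do their images [s a] because [s] is a bijection. The
    inverse is glued along the second partition. *)
Lemma glue_homeo (s : set X -> set X) (hs : set X -> homeo X) :
  set_bij (atoms A) (atoms A) s -> (forall a, atoms A a -> hs a @` a = s a) ->
  exists g : homeo X, forall a x, atoms A a -> a x -> g x = hs a x.
Proof.
move=> [sA sI sS] hsA.
have atopen a : atoms A a -> open a.
  by case=> Aa _ _; have [Acl _ _ _] := Aalg; case: (Acl _ Aa).
have /choice[at_ atP] : forall x, exists a, atoms A a /\ a x.
  by move=> x; have [a] := reg_cover HA x; exists a.
have /choice[pre preP] : forall x, exists a, atoms A a /\ s a = at_ x.
  by move=> x; have [a aA sa] := sS _ (atP x).1; exists a.
have atE a x : atoms A a -> a x -> at_ x = a.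
  by move=> aA ax; case: (atP x) => bA bx; exact: (atom_eq Aalg bA aA bx ax).
have preE a x : atoms A a -> s a x -> pre x = a.
  move=> aA sax; case: (preP x) => bA sb; apply: sI; rewrite ?inE //.
  by rewrite sb; apply: atE => //; exact: sA.
pose f x := hs (at_ x) x; pose f' x := ((hs (pre x))^-1)%g x.
have fE a x : atoms A a -> a x -> f x = hs a x.
  by move=> aA ax; rewrite /f (atE a).
have f'E a x : atoms A a -> s a x -> f' x = ((hs a)^-1)%g x.
  by move=> aA ax; rewrite /f' (preE a).
have fK : cancel f f'.
  move=> x; case: (atP x) => aA ax.
  rewrite (fE _ _ aA ax) (f'E _ _ aA) ?homeoVK //.
  by rewrite -hsA //; exists x.
have f'K : cancel f' f.
  move=> x; case: (preP x); move: (pre x) => a aA sax.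
  have sx : s a x by rewrite sax; case: (atP x).
  rewrite (f'E _ _ aA sx); move: sx; rewrite -hsA // => -[y ay <-].
  by rewrite homeoVK (fE _ _ aA ay).
have fc : continuous f.
  apply: locally_eq_continuous => x; case: (atP x) => aA ax.
  exists (at_ x), (hs (at_ x)); split=> //; first exact: atopen.
    exact: homeo_fun_continuous.
  by move=> y ay; exact: fE.
have f'c : continuous f'.
  apply: locally_eq_continuous => x; case: (preP x) => aA sax.
  exists (at_ x), ((hs (pre x))^-1)%g; case: (atP x) => bA bx; split=> //.
  - exact: atopen.
  - exact: homeo_fun_continuous.
  - by move=> y ay; apply: f'E => //; rewrite sax.
by exists (Homeo fK f'K fc f'c).
Qed.

(** Faithfulness is [F_agree]. For the image, a permutation preserving the orbits is realised on
    each atom by an element of [H], and these elements are glued. *)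
Lemma F_sum_of_Sym : is_sum_of_Sym F H A.
Proof.
split.
  move=> g g' /set_mem Fg /set_mem Fg' gg'; apply: homeo_ext => x.
  have [a aA ax] := reg_cover HA x; apply: (F_agree Fg Fg' aA _ ax).
  by rewrite -!act_atomsE // gg'.
have FV g : F g -> F (g^-1)%g by apply: subgroupV; exact: F_subgroup.
apply/seteqP; split=> [_ [g Fg <-]|s [[sbij sout] sO]].
  split; first split.
  - split.
    + by move=> a aA; rewrite act_atomsE //; exact: F_atom.
    + move=> a b /set_mem aA /set_mem bA; rewrite !act_atomsE // => gab.
      by rewrite -(image_homeoVK g a) gab image_homeoVK.
    + move=> b bA; have gbA := F_atom (FV g Fg) bA.
      by exists ((g^-1)%g @` b); rewrite // act_atomsE ?image_homeoKV.
  - exact: act_atoms_out.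
  - move=> O OO; apply/seteqP; split=> [_ [a Oa <-]|b Ob].
      by rewrite act_atomsE; [exact: F_orbit|exact: orbit_atoms Oa].
    have Ob' : O ((g^-1)%g @` b) by apply: F_orbit => //; exact: FV.
    exists ((g^-1)%g @` b) => //.
    by rewrite act_atomsE ?image_homeoKV //; exact: orbit_atoms Ob'.
(* Since [s] preserves the orbit of [a], it moves [a] to a translate of [a]. Off the atoms, [1] is a
   dummy value. *)
have sH a : exists h, atoms A a -> H h /\ h @` a = s a.
  have [aA|naA] := pselect (atoms A a); last by exists 1%g.
  have : [set h @` a | h in H] (s a).
    rewrite -(sO [set h @` a | h in H]); last by exists a.
    by exists a => //; exact: orbit_refl.
  by move=> [h Hh hs]; exists h.
have [hs hsP] := choice sH.
have [g gP] := glue_homeo sbij (fun a aA => (hsP a aA).2).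
exists g.
  apply/regularP => a aA; exists (hs a); first by case: (hsP a aA).
  by move=> x ax; exact: gP.
apply/funext => a; have [aA|naA] := pselect (atoms A a); last first.
  by rewrite act_atoms_out // sout.
rewrite act_atomsE // -(hsP a aA).2; apply: eq_imagel => x ax; exact: gP.
Qed.

End Regular.

(** * The block-diagonal embedding between two stages *)

Section BlockDiagonal.
Variables (X : topologicalType) (H1 H2 : set (homeo X)) (A1 A2 : set (set X)).
Hypotheses (HA1 : regular H1 A1) (HA2 : regular H2 A2).
Hypotheses (H12 : H1 `<=` H2) (A12 : A1 `<=` A2).
Let H1sub := reg_subgroup HA1.
Implicit Types (a b c : set X) (O Q : set (set X)).

(** An element of [H1] carrying [c] to [c'] carries [b] below [c']. *)
Lemma suborbit_below O Q b c c' : orbits H1 (atoms A1) O ->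
  orbits H1 (atoms A2) Q -> O c -> Q b -> b `<=` c -> O c' ->
  exists2 b', Q b' & b' `<=` c'.
Proof.
move=> OO [b0 b0A <-] Oc [k Hk <-] bc Oc'.
have [h Hh ->] := orbit_trans HA1 OO Oc Oc'.
exists (h @` (k @` b0)); last exact: image_subset.
by exists (h * k)%g; [exact: subgroupM|rewrite image_homeoM].
Qed.

(** An element of [H1] carrying [b] to [b'] maps [c] to an atom meeting [c], hence to [c] itself. By
    [reg_stab] it is the identity on [c], so [b = b']. *)
Lemma suborbit_inj O Q b b' c : orbits H1 (atoms A1) O ->
  orbits H1 (atoms A2) Q -> O c -> Q b -> Q b' -> b `<=` c -> b' `<=` c ->
  b = b'.
Proof.
move=> OO [b0 b0A <-] Oc [k Hk <-] [k' Hk' <-] bc b'c.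
have cA := orbit_atoms HA1 OO Oc.
have Hh : H1 (k' * k^-1)%g by apply: subgroupM => //; exact: subgroupV.
have hb : (k' * k^-1)%g @` (k @` b0) = k' @` b0.
  by rewrite image_homeoM image_homeoVK.
have [_ [x b0x] _] := b0A.
have hc : (k' * k^-1)%g @` c = c.
  apply: (atom_eq (reg_alg HA1) _ cA (x := k' x)).
  - exact: (subgroup_atom HA1).
  - exists (k x); first by apply: bc; exists x.
    by rewrite -[LHS]/(k' ((k^-1)%g (k x))) homeoVK.
  - by apply: b'c; exists x.
rewrite -hb -[LHS]image_id; apply: eq_imagel => y /bc cy.
by rewrite (reg_stab HA1 Hh cA hc cy).
Qed.

Lemma F_block_diagonal :
  block_diagonal (F_closure A1 H1) H1 A1 H2 A2.
Proof.
move=> O OO.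
have H1atom b h : H1 h -> atoms A2 b -> atoms A2 (h @` b).
  by move=> /H12 Hh; exact: (subgroup_atom HA2).
have Qatom Q b : orbits H1 (atoms A2) Q -> Q b -> atoms A2 b.
  by move=> [b0 b0A <-] [h Hh <-]; exact: H1atom.
have Qclosed Q b h : orbits H1 (atoms A2) Q -> Q b -> H1 h -> Q (h @` b).
  move=> [b0 b0A <-] [k Hk <-] Hh; exists (h * k)%g; first exact: subgroupM.
  exact: image_homeoM.
(* The blocks [O' j] are the [H1]-orbits on the finer atoms that have a member below a member of
   [O]. *)
pose D := [set Q | orbits H1 (atoms A2) Q /\
                   exists b c, [/\ Q b, O c & b `<=` c]].
have Dfin : finite_set D.
  apply: sub_finite_set (finite_powerset (reg_fin HA2)) => Q [QQ _] b Qb.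
  by have [] := Qatom _ _ QQ Qb.
have [r [O' [O'I O'D]]] := finite_set_enum Dfin.
have DO' j : D (O' j) by rewrite -O'D; exists j.
have QO' j : orbits H1 (atoms A2) (O' j) by case: (DO' j).
(* [phi j c] is the only member of [O' j] below [c]: it exists by [suborbit_below] and is unique by
   [suborbit_inj]. The default [set0] is never reached for [c] in [O]. *)
pose phi j c := xget set0 [set b | O' j b /\ b `<=` c].
have phiP j c : O c -> O' j (phi j c) /\ phi j c `<=` c.
  move=> Oc; case: (DO' j) => QQ [b [c0 [Qb Oc0 bc]]].
  have [b' Qb' bc'] := suborbit_below OO QQ Oc0 Qb bc Oc.
  exact: (@xgetPex _ _ [set b | O' j b /\ b `<=` c]
                   (ex_intro _ b' (conj Qb' bc'))).
have phiE j b c : O c -> O' j b -> b `<=` c -> phi j c = b.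
  move=> Oc Qb bc; have [Qp pc] := phiP j c Oc.
  exact: (suborbit_inj OO (QO' j) Oc Qp Qb pc bc).
have phiH j h c : H1 h -> O c -> phi j (h @` c) = h @` phi j c.
  move=> Hh Oc; have [Qp pc] := phiP j c Oc.
  apply: phiE; [exact: (orbit_closed HA1)|exact: Qclosed|exact: image_subset].
have orbD b c : atoms A2 b -> O c -> b `<=` c -> exists2 j, True & O' j b.
  move=> bA Oc bc.
  have Db : D [set h @` b | h in H1].
    by split; [exists b|exists b, c; split=> //; exact: (orbit_refl HA1)].
  move: Db; rewrite -O'D => -[j _ Ej]; exists j => //; rewrite Ej.
  exact: (orbit_refl HA1).
exists r, O', phi, (orbits H2 (atoms A2)); split=> //.
(* A finer atom meeting [a] lies below it, so its orbit is some [O' j]; then [0 < r] because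
   [j < r]. *)
- split=> //; have [a aA Oa] := OO; have [_ [x ax] _] := aA.
  have [b bA bx] := reg_cover HA2 x.
  have ba : b `<=` a.
    by apply: (atom_sub (reg_alg HA2) bA _ bx ax); apply: A12; case: aA.
  have Oa' : O a by rewrite -Oa; exact: (orbit_refl HA1).
  by have [[j jr] _ _] := orbD b a bA Oa' ba; exact: leq_ltn_trans jr.
- move=> j; split; last by move=> h c; exact: phiH.
  split.
  + by move=> c Oc; case: (phiP j c Oc).
  + move=> c c' /set_mem Oc /set_mem Oc' cc'.
    have [Qp pc] := phiP j c Oc; have [_ pc'] := phiP j c' Oc'.
    have [_ [x px] _] := Qatom _ _ (QO' j) Qp.
    apply: (atom_eq (reg_alg HA1) _ _ (pc _ px)).
    * exact: (orbit_atoms HA1 OO).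
    * exact: (orbit_atoms HA1 OO).
    * by apply: pc'; rewrite -cc'.
  + move=> b Qb; case: (DO' j) => QQ [b0 [c0 [Qb0 Oc0 bc0]]].
    have [h Hh bh] : exists2 h, H1 h & b = h @` b0.
      move: QQ Qb Qb0 => [b1 _ <-] [h Hh <-] [k Hk <-]; exists (h * k^-1)%g.
        by apply: subgroupM => //; exact: subgroupV.
      by rewrite image_homeoM image_homeoVK.
    exists (h @` c0); first exact: (orbit_closed HA1).
    apply: phiE => //; first exact: (orbit_closed HA1).
    by rewrite bh; exact: image_subset.
- split=> // j; have [b bA <-] := QO' j.
  exists [set h @` b | h in H2]; first by exists b.
  by move=> _ [h Hh <-]; exists h => //; exact: H12.
- move=> s g [_ sout] Fg gs; split.
  (* On [a], and so on [phi j a], the map [g] agrees with some [h] in [H1], and [phi j] commutes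
     with [h]. *)
  + move=> j a Oa; have aA := orbit_atoms HA1 OO Oa.
    have [Qp pa] := phiP j a Oa.
    rewrite act_atomsE; last exact: Qatom Qp.
    have [h [Hh ga gh]] := F_image HA1 Fg aA.
    rewrite -gs act_atomsE // ga phiH //; apply: eq_imagel => x px.
    exact/gh/pa.
  (* The coarse atom [c] above [b] is outside [O], so [g] stabilises it; by [F_stab], [g] is then
     the identity on [c]. *)
  + move=> b bA nb; rewrite act_atomsE //.
    have [_ [x bx] _] := bA; have [c cA cx] := reg_cover HA1 x.
    have bc : b `<=` c.
      by apply: (atom_sub (reg_alg HA2) bA _ bx cx); apply: A12; case: cA.
    have nOc : ~ O c by move=> Oc; have [j _ /nb] := orbD b c bA Oc bc.
    have gc : g @` c = c by rewrite -(act_atomsE g cA) gs sout.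
    have [_ gid] : pointwise_stab (F_closure A1 H1) c g.
      by rewrite -(F_stab HA1).
    by rewrite -[RHS]image_id; apply: eq_imagel => y /bc; exact: gid.
Qed.

End BlockDiagonal.

(** * The algebra generated by a finite invariant family of clopen sets *)

Section Saturated.
Variables (X : topologicalType) (S : set (set X)).

(* When S is finite, this is the algebra of sets generated by S. *)
Definition saturated : set (set X) :=
  [set U | forall x y, (forall V, S V -> V x <-> V y) -> U x -> U y].

Lemma sub_saturated : S `<=` saturated.
Proof. by move=> U SU x y xy /(xy _ SU). Qed.

(** A saturated set containing one point of an equivalence class contains the whole class. *)
Lemma saturated_cell x : atoms saturated [set y | forall V, S V -> V x <-> V y].
Proof.
split.
- by move=> y z yz xy V SV; rewrite (xy V SV); exact: yz.
- by exists x.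
- move=> U AU [y Uy] Ux; apply/seteqP; split=> // z xz.
  have xy := Ux _ Uy; apply: AU Uy => V SV.
  by rewrite -(xz V SV) (xy V SV).
Qed.

Lemma saturated_atomP a x y : atoms saturated a -> a x -> a y ->
  forall V, S V -> V x <-> V y.
Proof.
move=> [Aa _ amin] ax; have [Cc Cn _] := saturated_cell x.
by rewrite -(amin _ Cc Cn) // => z xz; exact: Aa ax.
Qed.

Hypothesis Sfin : finite_set S.

Lemma saturated_finite : finite_set saturated.
Proof.
(* A saturated set is the preimage under [f] of its own image, a family of subsets of the finite set
   [S]. *)
pose f x := [set V | S V /\ V x].
apply: (@sub_finite_set _ _
  ((fun P => f @^-1` P) @` [set P | P `<=` [set B | B `<=` S]])).
  move=> U AU; exists (f @` U); first by move=> _ [x Ux <-] V [].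
  apply/seteqP; split=> x; last by exists x.
  move=> [y Uy fyx]; apply: AU Uy => V SV.
  have := congr1 (fun P : set (set X) => P V) fyx.
  rewrite /f /= => E; split=> [Vy|Vx].
    by have: S V /\ V y by []; rewrite E => -[].
  by have: S V /\ V x by []; rewrite -E => -[].
exact/finite_image/finite_powerset/finite_powerset.
Qed.

Hypothesis Scl : S `<=` clopen.

(** Membership in each of the finitely many clopen generators is locally constant, so the class of
    [x] is a neighbourhood of [x]. *)
Lemma saturated_open U : saturated U -> open U.
Proof.
move=> AU; rewrite openE => x Ux.
have [n [e [_ eS]]] := finite_set_enum Sfin.
have eSt i : S (e i) by rewrite -eS; exists i.
have near_e : \forall y \near x, forall i, e i x <-> e i y.
  apply: filter_forall => i; have [eo ec] := Scl (eSt i).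
  have [ex|nex] := pselect (e i x).
    by apply: filterS (open_nbhs_nbhs (conj eo ex)).
  apply: filterS (open_nbhs_nbhs (conj (closed_openC ec) nex)) => y ney.
  by split.
apply: filterS near_e => y xy; apply: AU Ux => V.
by rewrite -eS => -[i _ <-].
Qed.

Lemma saturated_alg : is_subalgebra saturated.
Proof.
have AC : setC_closed saturated.
  by move=> U AU x y xy nUx Uy; apply/nUx/AU/Uy => V SV; rewrite xy.
split=> //.
- move=> U AU; split; first exact: saturated_open.
  by rewrite -openC; exact/saturated_open/AC.
- by move=> U V AU AV x y xy [Ux|Vx]; [left; exact: AU Ux|right; exact: AV Vx].
Qed.

Variable H : set (homeo X).
Hypothesis Hsub : subgroup H.
Hypothesis HS : Defs.invariant H S.
Hypothesis Ssep : forall h x, H h -> h x <> x ->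
  exists V, [/\ S V, V x & ~ V (h x)].

(** Generators do not separate points of one atom. If [h] stabilises [a] and [x] lies in [a], then
    so does [h x], and [Ssep] forces [h x = x]. *)
Lemma saturated_regular : regular H saturated.
Proof.
split=> //; [exact: saturated_alg|exact: saturated_finite| | |].
- by move=> x; eexists; first exact: (saturated_cell x).
- move=> h U Hh AU x y xy; rewrite image_homeo_preimage.
  apply: AU => V SV; have := xy _ (HS Hh SV).
  by rewrite image_homeo_preimage.
- move=> h a x Hh aA ha ax; apply: contrapT => /(Ssep Hh)[V [SV Vx]]; apply.
  apply: (iffLR (saturated_atomP aA ax _ SV)) Vx.
  by rewrite -ha; exists x.
Qed.

End Saturated.

(** * Construction of the sequence of algebras *)

Lemma finite_clopen_separation (X : topologicalType) (h : homeo X) :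
  cover_compact [set: X] -> zero_dimensional X -> clopen (Fix h) ->
  exists T : set (set X), [/\ finite_set T, T `<=` clopen &
    forall x, h x <> x -> exists V, [/\ T V, V x & ~ V (h x)]].
Proof.
move=> Xc X0 [Fo Fc].
(* Adding the open set [Fix h] to every member makes the family cover the fixed points too; a moved
   point must still lie in the second part. *)
pose f (V : set X) := Fix h `|` (V `&` h @^-1` (~` V)).
have fo (V : set X) : clopen V -> open (f V).
  move=> Vcl; apply: openU => //.
  suff [] : clopen (V `&` h @^-1` (~` V)) by [].
  apply: clopenI => //; apply: preimage_clopen; first exact: clopenC.
  exact: homeo_fun_continuous.
have fcover : [set: X] `<=` cover clopen f.
  move=> x _; have [hx|hx] := pselect (h x = x).
    by exists setT; [exact: clopenT|left].
  have [|V [Vcl Vx nVhx]] := X0 x (h x); first by apply/eqP => /esym.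
  by exists V => //; right.
have [D Dcl Dcover] := Xc _ _ _ fo fcover.
eexists; split; first exact: (finite_fset D).
  by move=> V /Dcl /set_mem.
move=> x hx; have [V DV [//|[Vx nVhx]]] := Dcover x Logic.I.
by exists V.
Qed.

(** [T0] holds extra generators, so that the atoms can be made to refine a prescribed partition. *)
Lemma ample_regular_sequence (X : topologicalType) (G : set (homeo X))
    (H : nat -> set (homeo X)) (T0 : set (set X)) :
  cover_compact [set: X] -> zero_dimensional X ->
  ample G -> direct_union G H -> finite_set T0 -> T0 `<=` clopen ->
  exists Bs : nat -> set (set X),
    [/\ forall n, regular (H n) (Bs n), forall n, Bs n `<=` Bs n.+1 &
        forall n, T0 `<=` Bs n].
Proof.
move=> Xc X0 [_ _ _ _ Fixcl] [Hsub Hfin HS GE] T0fin T0cl.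
(* The separating family [T h] is chosen once for each [h], independently of [n]; this makes the
   generators increase with [n]. *)
have /choice[T TP] : forall h, exists T : set (set X), G h ->
    [/\ finite_set T, T `<=` clopen &
      forall x, h x <> x -> exists V, [/\ T V, V x & ~ V (h x)]].
  move=> h; have [Gh|] := pselect (G h); last by exists set0.
  by have [T] := finite_clopen_separation Xc X0 (Fixcl _ Gh); exists T.
have HG n h : H n h -> G h by rewrite GE => Hh; exists n.
pose W n := T0 `|` \bigcup_(h in H n) T h.
(* Taking all translates makes the finite generating family [H n]-invariant. *)
pose S n := [set h @` V | h in H n & V in W n].
have WS n : W n `<=` S n.
  move=> V WV; exists 1%g; first exact: (subgroup1 (Hsub n)).
  by exists V => //; exact: image_homeo1.
have SW n : S n `<=` S n.+1.
  move=> _ [h Hh [V WV <-]]; exists h; first exact: HS.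
  exists V => //; case: WV => [TV|[k Hk TV]]; first by left.
  by right; exists k => //; exact: HS.
exists (fun n => saturated (S n)); split=> n.
- apply: saturated_regular => //.
  + apply: finite_image2 => //; rewrite finite_setU; split=> //.
    by apply: bigcup_finite => // h /HG /TP[].
  + move=> _ [h Hh [V WV <-]]; apply: image_homeo_clopen.
    by case: WV => [/T0cl//|[k /HG /TP[_ Tcl _] /Tcl]].
  + move=> k _ Hk [h Hh [V WV <-]]; exists (k * h)%g; first exact: subgroupM.
    by exists V => //; exact: image_homeoM.
  + move=> h x Hh hx; have [_ _ Tsep] := TP h (HG _ _ Hh).
    have [V [TV Vx nVhx]] := Tsep x hx.
    by exists V; split=> //; apply: WS; right; exists h.
- by move=> U AU x y xy; apply: AU => V SV; exact/xy/SW.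
- by move=> V TV; apply: sub_saturated; apply: WS; left.
Qed.

(** Piecewise fullness of [G] keeps the closures inside [G], and monotonicity of the closure makes
    them increase. *)
Lemma regular_block_diagonal_sequence (X : topologicalType)
    (G : set (homeo X)) (H : nat -> set (homeo X)) (Bs : nat -> set (set X)) :
  ample G -> direct_union G H ->
  (forall n, regular (H n) (Bs n)) -> (forall n, Bs n `<=` Bs n.+1) ->
  block_diagonal_sequence G H (fun n => F_closure (Bs n) (H n)) Bs.
Proof.
move=> [_ [_ Gfull] _ _ _] [_ _ HS GE] HB BS n.
have B := HB n; split; split.
- exact: F_subgroup.
- exact: F_finite.
- rewrite -[X in _ `<=` X]Gfull; apply: F_closure_mono.
    by case: (reg_alg B).
  by rewrite GE => h Hh; exists n.
- exact: reg_alg B.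
- exact: reg_fin B.
- exact: subgroup_sub_F.
- exact: reg_inv B.
- split; first exact: F_piecewise_full.
  exact: F_stab.
- exact: F_sum_of_Sym.
- split; first exact: F_closure_mono.
  exact: F_block_diagonal.
Qed.

(** If two translates of [a] lie in the same part, the two images of each point of [a] are in one
    [G]-orbit and in that part, hence equal. So an orbit injects into the set of parts. *)
Lemma regular_adapted (X : topologicalType) (G : set (homeo X))
    (H : nat -> set (homeo X)) (Bs : nat -> set (set X)) (k : nat)
    (U : 'I_k -> set X) :
  direct_union G H -> (forall n, regular (H n) (Bs n)) ->
  (forall n i, Bs n (U i)) ->
  clopen_partition U -> uniformly_discrete G U -> adapted_to U H Bs.
Proof.
move=> [_ _ _ GE] HB BU [[Uc _ _] _] Gdisc n.
have atU a : atoms (Bs n) a -> exists i, a `<=` U i.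
  move=> aA; have [_ [x ax] _] := aA.
  have [i _ Uix] : cover setT U x by rewrite Uc.
  exists i; exact: (atom_sub (reg_alg (HB n)) aA (BU n i) ax).
split=> // O OO.
have HG h : H n h -> G h by rewrite GE => Hh; exists n.
have O1 i : is_subset1 (O `&` [set a | a `<=` U i]).
  move: OO => [a aA <-] _ _ [[h Hh <-] ha] [[l Hl <-] la].
  apply: eq_imagel => x ax; apply: (Gdisc x i).
    by split; [exists h => //; exact: HG|apply: ha; exists x].
  by split; [exists l => //; exact: HG|apply: la; exists x].
split=> //.
(* The option type supplies a value outside [O] even when ['I_k] is empty. *)
have /choice[idx idxP] : forall a, exists i : option 'I_k, O a ->
    exists2 j, i = Some j & a `<=` U j.
  move=> a; have [Oa|] := pselect (O a); last by exists None.
  have [i ai] := atU a (orbit_atoms (HB n) OO Oa).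
  by exists (Some i) => _; exists i.
have idxI : {in O &, injective idx}.
  move=> a b /set_mem Oa /set_mem Ob ab.
  have [i ai aU] := idxP a Oa; have [j bj bU] := idxP b Ob.
  move: ab; rewrite ai bj => -[ij]; apply: (O1 i); split=> //.
  by rewrite ij.
rewrite -(card_le_eql (inj_card_eq idxI)) (card_le_eqr card_II).
rewrite -(card_le_eqr card_some).
by apply: subset_card_le => _ [a /idxP[i -> _] <-]; exists i.
Qed.

Theorem proposition3p1 (G : set (homeo cantor_space))
    (H : nat -> set (homeo cantor_space)) :
  ample G -> direct_union G H ->
  (exists (Gs : nat -> set (homeo cantor_space))
          (Bs : nat -> set (set cantor_space)),
     block_diagonal_sequence G H Gs Bs) /\
  (forall (k : nat) (U : 'I_k -> set cantor_space),
     clopen_partition U -> uniformly_discrete G U ->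
     exists (Gs : nat -> set (homeo cantor_space))
            (Bs : nat -> set (set cantor_space)),
       block_diagonal_sequence G H Gs Bs /\ adapted_to U H Bs).
Proof.
move=> Gample GH.
have Xc : cover_compact [set: cantor_space].
  by rewrite -compact_cover; exact: cantor_space_compact.
have X0 := cantor_zero_dimensional.
split.
  have [Bs [HB BS _]] := ample_regular_sequence Xc X0 Gample GH
    (finite_set0 _) (@sub0set _ _).
  by eexists; exists Bs; exact: regular_block_diagonal_sequence.
move=> k U Upart Gdisc.
have Ufin : finite_set (range U) by exact/finite_image/finite_finset.
have Ucl : range U `<=` clopen by move=> _ [i _ <-]; case: Upart.
(* The parts of the partition are the extra generators; for the first claim there were none. *)
have [Bs [HB BS UB]] := ample_regular_sequence Xc X0 Gample GH Ufin Ucl.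
eexists; exists Bs; split; first exact: regular_block_diagonal_sequence.
by apply: (regular_adapted GH HB _ Upart Gdisc) => n i; apply: UB; exists i.
Qed.
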